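(* For every positive integer $n$ with $n\not\equiv 0\pmod 4$, let $C_n$ be the curve $y^2=(x^4+1)(x^n+1)$. Then $$C_n(\mathbb{Z})\subset\{(-1,0),(1,2),(1,-2),(-1,2),(-1,-2),(0,1),(0,-1)\}.$$
   Context: $C_n(\mathbb{Z})$ denotes the set of integer points $(x,y)\in\mathbb{Z}^2$ of $C_n$. *)

(* Defs.v *)
From mathcomp Require Import all_boot all_order all_algebra.

Set Implicit Arguments.
Unset Strict Implicit.
Unset Printing Implicit Defensive.

Import GRing.Theory.
Local Open Scope ring_scope.

(* The R-points of the affine plane curve y^2 = (x^4 + 1)(x^n + 1); a pair p
   stands for (x, y).  The integral points C_n(Z) are [curve int n]. *)
Definition curve (R : comNzRingType) (n : nat) : pred (R * R) :=
  [pred p | p.2 ^+ 2 == (p.1 ^+ 4 + 1) * (p.1 ^+ n + 1)].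
Arguments curve R n : clear implicits.

(* Main.v *)
(* As 4 does not divide n, the gcd of x^4 + 1 and x^n + 1 divides 2, so x^4 + 1
   is a square or twice a square.  A square forces x = 0; x^4 + 1 = 2 u^2 forces
   x = 1 or x = -1 by Fermat's descent on p^4 - q^4 = r^2. *)
Require Import Defs.
From mathcomp Require Import all_boot all_order all_algebra.
From mathcomp Require Import zify ring.

Set Implicit Arguments.
Unset Strict Implicit.
Unset Printing Implicit Defensive.

Import GRing.Theory.
Local Open Scope ring_scope.

(** The witness is [gcdn a c]: its square is the gcd of [a^2], [a c] and [c^2 = a b], which is [a]
    times the gcd of [a], [b], [c]. *)
Lemma coprime_mul_sqr (a b c : nat) :
  coprime a b -> (a * b = c ^ 2)%N -> exists e, a = (e ^ 2)%N.
Proof.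
move=> /eqP cop_ab abE; exists (gcdn a c).
rewrite -mulnn muln_gcdr !muln_gcdl !mulnn -abE (mulnC c a) -mulnn.
by rewrite -!muln_gcdr (gcdnC c b) gcdnACA cop_ab gcd1n muln1.
Qed.

Lemma coprime_mul_sqr2 (a b c : nat) : coprime a b -> (a * b = c ^ 2)%N ->
  exists e f, a = (e ^ 2)%N /\ b = (f ^ 2)%N.
Proof.
move=> cop_ab abE; have [e eE] := coprime_mul_sqr cop_ab abE.
have [f fE] : exists f, b = (f ^ 2)%N.
  by apply: (@coprime_mul_sqr b a c); rewrite 1?coprime_sym 1?mulnC.
by exists e, f.
Qed.

(** As [y] is even, the halves of [z - x] and [z + x] are coprime with product [(y / 2)^2], so both
    are squares. *)
Lemma pythagorean_triple (x y z : nat) : odd x -> coprime x y ->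
    (x ^ 2 + y ^ 2 = z ^ 2)%N ->
  exists m k, [/\ coprime m k, (x + k ^ 2 = m ^ 2)%N, y = (2 * (m * k))%N
                & z = (m ^ 2 + k ^ 2)%N].
Proof.
move=> odd_x cop_xy xyz.
have [w yE] : exists w, y = (2 * w)%N.
  case odd_y : (odd y); last by exists y./2; lia.
  (* Two odd squares sum to 2 modulo 4, which is not a square. *)
  have [[i xE] [j yE]] : (exists i, x = (2 * i).+1) /\ (exists j, y = (2 * j).+1).
    by split; [exists x./2 | exists y./2]; lia.
  have [l zE] : exists l, z = (2 * l)%N \/ z = (2 * l).+1.
    by exists z./2; lia.
  by case: zE => zE; move: xyz; rewrite xE yE zE -!mulnn; lia.
have [a [b [xE zE]]] : exists a b, (x + a = b /\ z = a + b)%N.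
  have odd_z : odd z.
    by move: (congr1 odd xyz); rewrite yE oddD !oddX odd_x oddM.
  have le_xz : (x <= z)%N by rewrite -leq_sqr -xyz leq_addr.
  by exists ((z - x)./2), ((z + x)./2); lia.
have abE : (a * b = w ^ 2)%N.
  by move: xyz; rewrite yE zE -xE -!mulnn; lia.
have cop_ab : coprime a b.
  have dvd_x : (gcdn a b %| x)%N.
    by rewrite -(dvdn_addl _ (dvdn_gcdl a b)) xE dvdn_gcdr.
  have dvd_w : (gcdn a b %| w ^ 2)%N by rewrite -abE dvdn_mulr ?dvdn_gcdl.
  have cop_xw : coprime x (w ^ 2).
    by move: cop_xy; rewrite yE coprimeMr => /andP[_ /(coprimeXr 2)].
  by rewrite /coprime -dvdn1 -(eqP cop_xw) dvdn_gcd dvd_x.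
have [e [f [aE bE]]] := coprime_mul_sqr2 cop_ab abE.
exists f, e; split.
- by move: cop_ab; rewrite aE bE coprime_pexpl // coprime_pexpr // coprime_sym.
- by rewrite -aE xE.
- have : (w ^ 2 == (f * e) ^ 2)%N by rewrite -abE aE bE expnMn mulnC.
  by rewrite eqn_sqr yE => /eqP ->.
- by rewrite -aE -bE addnC.
Qed.

(* Fermat's descent for the difference of two fourth powers: the two nested
   Pythagorean triples (r, q^2, p^2) and (e^2, 2 f^2, p) turn a solution
   (p, q, r) into a solution (s, t, e) with p = s^4 + t^4. *)
Lemma sub_pow4_eq_sqr (p q r : nat) : odd r -> coprime p q ->
  (p ^ 4 = q ^ 4 + r ^ 2)%N -> q = 0%N.
Proof.
elim/ltn_ind: p q r => p IHp q r odd_r cop_pq pqr.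
have cop_rq : coprime r (q ^ 2).
  have : coprime (p ^ 4) (q ^ 2) by rewrite coprimeXl ?coprimeXr.
  rewrite pqr (expnM q 2 2) -[((_ ^ 2) ^ 2)%N]mulnn /coprime gcdnC gcdnMDl gcdnC.
  by rewrite -/(coprime _ _) coprime_pexpl.
have [|m [k [cop_mk rE qE pE]]] := @pythagorean_triple r (q ^ 2) (p ^ 2) odd_r cop_rq.
  by rewrite -!expnM pqr addnC.
have odd_mk : odd m || odd k.
  by move: (congr1 odd rE); rewrite oddD !oddX odd_r /=; case: odd; case: odd.
(* Only [rE] distinguishes [m] from [k]; once it is dropped, they can be swapped to make [m] odd. *)
clear rE; wlog odd_m : m k cop_mk qE pE odd_mk / odd m.
  move=> IH; case/orP: (odd_mk) => [|odd_k]; first exact: (IH m k).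
  by apply: (IH k m); rewrite // 1?coprime_sym 1?orbC // 1?addnC // 1?(mulnC k).
have [q' q'E] : exists q', q = (2 * q')%N.
  have : ~~ odd q by move: (congr1 odd qE); rewrite oddX oddM /= => ->.
  by exists q./2; lia.
have mkE : (m * k = 2 * q' ^ 2)%N by move: qE; rewrite q'E -!mulnn; lia.
have [k' k'E] : exists k', k = (2 * k')%N.
  have : ~~ odd k by move: (congr1 odd mkE); rewrite !oddM odd_m /= => ->.
  by exists k./2; lia.
have cop_mk' : coprime m k'.
  by move: cop_mk; rewrite k'E coprimeMr => /andP[].
have [|e [f [mE fE]]] := coprime_mul_sqr2 cop_mk' (c := q').
  by move: mkE; rewrite k'E; lia.
have odd_e : odd e by move: odd_m; rewrite mE oddX.
have [|||g [h [cop_gh gE ghE pgh]]] :=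
    @pythagorean_triple (e ^ 2) (2 * f ^ 2) p.
- by rewrite oddX.
- by rewrite -mE -fE -k'E.
- by rewrite -mE -fE -k'E pE.
have [|s [t [sE tE]]] := coprime_mul_sqr2 cop_gh (c := f).
  by apply/eqP; rewrite -(eqn_pmul2l (m := 2)) // -ghE.
(* Here [s^4 = t^4 + e^2], and [t > 0] would give [s <= s^4 < s^4 + t^4 = p], so the induction
   hypothesis applies to [s]. *)
have t0 : t = 0%N.
  case: (posnP t) => // t_gt0; apply: (IHp s _ t e) => //.
  - rewrite pgh sE tE -!expnM.
    have s_gt0 : (0 < s)%N.
      rewrite lt0n; apply/eqP => s0; move/eqP: gE.
      rewrite sE s0 addn_eq0 !expn_eq0 /= !andbT => /andP[/eqP e0 _].
      by rewrite e0 in odd_e.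
    apply: leq_ltn_trans (leq_pexp2l s_gt0 (isT : (1 <= 4)%N)) _.
    by rewrite -[ltnLHS]addn0 ltn_add2l expn_gt0 t_gt0.
  - by move: cop_gh; rewrite sE tE coprime_pexpl // coprime_pexpr.
  - by move: gE; rewrite sE tE -!expnM addnC => <-.
move/eqP: ghE; rewrite tE t0 !muln0 muln_eq0 expn_eq0 /= andbT => /eqP f0.
by move: qE; rewrite k'E fE f0 !muln0 => /eqP; rewrite expn_eq0 => /andP[/eqP].
Qed.

(** For positive [x], [x^4 + 1] lies strictly between the squares of [x^2] and [x^2 + 1]. *)
Lemma pow4S_sqr (x u : nat) : (x ^ 4 + 1 = u ^ 2)%N -> x = 0%N.
Proof.
rewrite (expnM x 2 2); case: x => // x xu.
have : (x.+1 ^ 2 < u)%N by rewrite -ltn_sqr -xu addn1.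
have : (0 < x.+1 ^ 2)%N by rewrite expn_gt0.
by move: xu; set X := (x.+1 ^ 2)%N; rewrite -!mulnn; nia.
Qed.

(* Since x is odd, u^4 - x^4 = ((x^4 - 1) / 2)^2; the Pythagorean triple
   (x^2, (x^4 - 1) / 2, u^2) then makes (x u)^2 a difference of two fourth
   powers. *)
Lemma pow4S_double_sqr (x u : nat) : (x ^ 4 + 1 = 2 * u ^ 2)%N -> x = 1%N.
Proof.
move=> xu.
have odd_x : odd x.
  by move: (congr1 odd xu); rewrite oddD oddX oddM /=; case: odd.
have [c cE] : exists c, (x ^ 4 = 2 * c + 1)%N.
  exists (x ^ 4)./2; have : odd (x ^ 4) by rewrite oddX odd_x.
  by lia.
have uE : (u ^ 2 = c + 1)%N by lia.
have cop : coprime (x ^ 2) c.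
  have : coprime (x ^ 4) c by rewrite cE /coprime gcdnC gcdnMDl gcdn1.
  by rewrite !coprime_pexpl.
have [|||p [q [cop_pq xE _ uE2]]] := @pythagorean_triple (x ^ 2) c (u ^ 2).
- by rewrite oddX odd_x.
- by [].
- by rewrite uE -expnM cE; ring.
(* Indeed [(x u)^2 = (p^2 - q^2) (p^2 + q^2) = p^4 - q^4]. *)
have q0 : q = 0%N.
  apply: (@sub_pow4_eq_sqr p q (x * u)) => //.
    move: (congr1 odd uE2) (congr1 odd xE).
    by rewrite !oddD !oddX oddM odd_x /=; case: (odd p); case: (odd q); case: (odd u).
  by rewrite expnMn uE2 !(expnM _ 2 2) -xE; ring.
have : (x ^ 2 == u ^ 2)%N by rewrite uE2 -xE q0 exp0n // !addn0.
rewrite eqn_sqr => /eqP ux; move: xu; rewrite -ux (expnM x 2 2) => xu.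
(* With [u = x], [x^4 + 1 = 2 x^2] is the equality case of [2 a b <= a^2 + b^2] at [a = x^2],
   [b = 1], which forces [a = b]. *)
have [_] := nat_Cauchy (x ^ 2) 1.
rewrite muln1 exp1n -xu eqxx => /esym.
by rewrite -[X in _ == X](exp1n 2) eqn_sqr => /eqP.
Qed.

(** If the gcd is 2, then [a / 2] and [b / 2] are coprime with product [(c / 2)^2]. *)
Lemma gcdn_dvd2_mul_sqr (a b c : nat) : (gcdn a b %| 2)%N -> (a * b = c ^ 2)%N ->
  exists u, a = (u ^ 2)%N \/ a = (2 * u ^ 2)%N.
Proof.
have [_ dvd2] := primeP (isT : prime 2); move=> /dvd2/orP[gcd1|/eqP gcd2] abE.
  by have [u uE] := coprime_mul_sqr gcd1 abE; exists u; left.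
have [a' aE] : exists a', a = (a' * 2)%N.
  by apply/dvdnP; rewrite -gcd2 dvdn_gcdl.
have [b' bE] : exists b', b = (b' * 2)%N.
  by apply/dvdnP; rewrite -gcd2 dvdn_gcdr.
have cop : coprime a' b'.
  by move/eqP: gcd2; rewrite aE bE -muln_gcdl -[X in _ == X]mul1n eqn_pmul2r.
have [c' cE] : exists c', c = (2 * c')%N.
  have : ~~ odd c by move: (congr1 odd abE); rewrite aE oddX !oddM andbF /= => <-.
  by exists c./2; lia.
have [|u uE] := @coprime_mul_sqr a' b' c' cop.
  by move: abE; rewrite aE bE cE -!mulnn; lia.
by exists u; right; rewrite aE uE mulnC.
Qed.

(* Writing m for the odd part of n, a common divisor divides
   x^(4m) + 1 and x^(4m) - 1. *)
Lemma gcdz_pow4S_pow (x : int) (n : nat) : n <> 0 %[mod 4] ->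
  (gcdz (x ^+ 4 + 1) (x ^+ n + 1) %| 2)%Z.
Proof.
move=> n_mod4; set d := gcdz _ _.
(* The exponent [4 m] is an odd multiple of 4 and an even multiple of [n], so [x^4 + 1] divides
   [x^(4m) + 1] and [x^n + 1] divides [x^(4m) - 1]. *)
have [m [odd_m [l nE]]] : exists m, odd m /\ exists l, (4 * m = n * (2 * l))%N.
  case odd_n : (odd n); first by exists n; split=> //; exists 2%N; lia.
  by exists n./2; split; [lia | exists 1%N; lia].
have dvdD (y : int) k : odd k -> (y + 1 %| y ^+ k + 1)%Z.
  move=> odd_k; have -> : y ^+ k + 1 = y ^+ k - (-1) ^+ k.
    by rewrite -signr_odd odd_k expr1 opprK.
  by rewrite subrXX opprK dvdz_mulr.
have dvd_add : (d %| x ^+ (4 * m) + 1)%Z.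
  by apply: dvdz_trans (dvdz_gcdl _ _) _; rewrite exprM dvdD.
have dvd_sub : (d %| x ^+ (4 * m) - 1)%Z.
  apply: dvdz_trans (dvdz_gcdr _ _) _.
  rewrite nE exprM exprM subrX1 subr_sqr_1 -mulrA mulrCA.
  exact: dvdz_mulr.
have -> : 2%Z = (x ^+ (4 * m) + 1) - (x ^+ (4 * m) - 1) by ring.
exact: rpredB.
Qed.

Theorem corollary3p14 (n : nat) (n_gt0 : (0 < n)%N)
    (n_mod4 : n <> 0 %[mod 4]) :
  {subset curve int n <=
     [:: (-1, 0); (1, 2); (1, -2); (-1, 2); (-1, -2); (0, 1); (0, -1)]}.
Proof.
move=> [x y]; rewrite inE /= => /eqP xyE.
have absA : absz (x ^+ 4 + 1) = (`|x| ^ 4 + 1)%N.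
  have -> : x ^+ 4 + 1 = ((`|x| ^ 4 + 1)%N : int).
    by rewrite PoszD -abszX gez0_abs // Num.Theory.exprn_even_ge0.
  by [].
have [u [xu|xu]] : exists u,
    absz (x ^+ 4 + 1) = (u ^ 2)%N \/ absz (x ^+ 4 + 1) = (2 * u ^ 2)%N.
- apply: (@gcdn_dvd2_mul_sqr _ (absz (x ^+ n + 1)) `|y|%N).
    exact: gcdz_pow4S_pow.
  by rewrite -abszM -xyE abszX.
- have x0 : x = 0 by apply/eqP; rewrite -absz_eq0 (@pow4S_sqr `|x| u) -?absA.
  have y2 : y ^+ 2 = 1 by rewrite xyE x0 !expr0n (gtn_eqF n_gt0) /= !add0r mulr1.
  by move/eqP: y2; rewrite sqrf_eq1 => /orP[]/eqP ->; rewrite x0 !inE.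
have : x \in [:: 1; -1].
  have := @pow4S_double_sqr `|x| u; rewrite -absA => /(_ xu) x1.
  by rewrite !inE; lia.
have y4 : y ^+ 2 = 2 ^+ 2 -> y \in [:: 2; -2].
  by move/eqP; rewrite eqf_sqr !inE.
rewrite !inE => /orP[]/eqP x1; move: xyE; rewrite x1.
  by rewrite !expr1n => /y4; rewrite !inE => /orP[]/eqP ->.
(* At [x = -1], even [n] gives [y^2 = 4] and odd [n] gives [y = 0]. *)
rewrite -(signr_odd _ n); case: (odd n); last first.
  by move/y4; rewrite !inE => /orP[]/eqP ->.
by rewrite expr1 addNr mulr0 => /eqP; rewrite expf_eq0 => /andP[_ /eqP ->].
Qed.
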